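(* Let $f\colon D\to\mathbb{R}$ be a $C^3$ function defined in an open disk $D\subset\mathbb{R}^2$. The following three conditions are equivalent: (1) Through a generic point of the graph of $f$ there passes a line segment completely contained in the graph. (2) For each $(x,y)\in D$, the two equations $$f_{xx}u^2+2f_{xy}uv+f_{yy}v^2=0,\qquad f_{xxx}u^3+3f_{xxy}u^2v+3f_{xyy}uv^2+f_{yyy}v^3=0$$ (with the derivatives evaluated at $(x,y)$) have a common nonzero real solution $(u,v)$. (3) For each $(x,y)\in D$ we have $f_{xx}f_{yy}-f_{xy}^2\le 0$ (i.e., the Gaussian curvature of the graph is nonpositive) and $$\begin{aligned} &f_{yy}^3f_{xxx}^2+6f_{yy}f_{xxx}f_{yyy}f_{xy}f_{xx}-6f_{yy}^2f_{xxx}f_{xyy}f_{xx}-6f_{yyy}f_{xy}f_{xx}^2f_{xyy}\\ &+9f_{yy}f_{xyy}^2f_{xx}^2-6f_{xy}f_{yy}^2f_{xxy}f_{xxx}+12f_{xy}^2f_{xxy}f_{yyy}f_{xx}-18f_{xy}f_{yy}f_{xxy}f_{xyy}f_{xx}\\ &+12f_{yy}f_{xyy}f_{xy}^2f_{xxx}-8f_{yyy}f_{xy}^3f_{xxx}+9f_{xx}f_{yy}^2f_{xxy}^2-6f_{yy}f_{xxy}f_{yyy}f_{xx}^2+f_{yyy}^2f_{xx}^3=0. \end{aligned}$$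
   Context: A subset is called negligible if it is a countable union of subsets such that the closure of each one has no interior points. An assertion holds at a generic point if it holds outside a negligible set (points of the graph of $f$ are identified with points of $D$ by vertical projection). A line segment passing through a point $(x,y,z)$ is a nondegenerate segment of the form $(x+ut,y+vt,z+wt)$, $t\in(-\epsilon,\epsilon)$, with $\epsilon>0$ and fixed $u,v,w\in\mathbb{R}$. *)

(* Defs.v *)
From mathcomp Require Import all_boot all_order all_algebra.
From mathcomp Require Import all_classical all_reals all_analysis.

Set Implicit Arguments.
Unset Strict Implicit.
Unset Printing Implicit Defensive.

Import Order.TTheory GRing.Theory Num.Theory.
Import numFieldNormedType.Exports.

Local Open Scope classical_set_scope.
Local Open Scope ring_scope.

(* The norm of [R * R] is the sup norm, so its [ball]s are squares. *)
Definition open_disk (R : realType) (c : R * R) (r : R) : set (R * R) :=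
  [set p | (p.1 - c.1) ^+ 2 + (p.2 - c.2) ^+ 2 < r ^+ 2].

Definition dx (R : realType) (f : R * R -> R) : R * R -> R :=
  'D_((1, 0) : R * R) f.

Definition dy (R : realType) (f : R * R -> R) : R * R -> R :=
  'D_((0, 1) : R * R) f.

(* For [D] open: all iterated partial derivatives of order at most [k], in any
   order of differentiation, exist and are continuous on [D]. A function on [D]
   is represented by a total function; on an open [D] its values outside [D]
   are irrelevant to its partial derivatives at points of [D]. *)
Fixpoint C_ (R : realType) (k : nat) (D : set (R * R)) (f : R * R -> R) : Prop :=
  (forall p, D p -> {for p, continuous f}) /\
  if k is k'.+1 then
    [/\ forall p, D p -> derivable f p ((1, 0) : R * R),
        forall p, D p -> derivable f p ((0, 1) : R * R),
        C_ k' D (dx f) & C_ k' D (dy f)]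
  else True.

Definition nowhere_dense (T : topologicalType) (A : set T) : Prop :=
  interior (closure A) = set0.

(* Topological notion (meager set), not the measure-theoretic [negligible]. *)
Definition meager (T : topologicalType) (A : set T) : Prop :=
  exists F : nat -> set T,
    (forall n, nowhere_dense (F n)) /\ A = \bigcup_n F n.

(* For [D] open, being meager in [D] and in the whole space are the same. *)
Definition generic (T : topologicalType) (D : set T) (P : T -> Prop) : Prop :=
  exists N : set T, [/\ meager N, N `<=` D & forall p, D p -> ~ N p -> P p].

Definition graph (R : realType) (D : set (R * R)) (f : R * R -> R) :
    set (R * R * R) :=
  [set q | D q.1 /\ q.2 = f q.1].

Definition line_segment_through (R : realType) (q : R * R * R)
    (S : set (R * R * R)) : Prop :=
  exists u v w e : R, [/\ (u, v, w) <> (0, 0, 0), 0 < e &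
    S = [set (q.1.1 + u * t, q.1.2 + v * t, q.2 + w * t) | t in `]- e, e[]].

(* Main.v *)
(* If a segment in direction (u, v) lies on the graph, then differentiating [f]
   two and three times along it gives the two equations of (2) at its points.
   Pointwise, (2) says that the two binary forms have a common real root, i.e.
   that the quadratic form has a real root and that the resultant, which is the
   left-hand side of (3), vanishes. Condition (3) is closed, so by Baire it is
   enough to have it at generic points.

   Conversely, it suffices to find segments on a dense open set. Where [fyy]
   vanishes identically, vertical segments work. Where [fyy <> 0], the common
   root is a continuous slope [m] on a smaller open set (two simple roots if the
   discriminant is positive somewhere, the double root if it vanishes
   identically; in the latter case differentiating the discriminant yields the
   third-order equations). Fix [p0] and follow the line through [p0] with slope
   [m0 := m p0]: the second derivative [h] of [f] along it satisfies [h 0 = 0]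
   and [h' = r h] with [r] continuous, because both [h] and [h'] are divisible by
   [m0 - m], to the order 1 or 2 according to the case. Hence [h = 0] by
   Gronwall, and [f] is affine on the line; no integral curve of the direction
   field has to be constructed. *)

From HB Require Import structures.
Require Import Defs.
From mathcomp Require Import all_boot all_order all_algebra.
From mathcomp Require Import all_classical all_reals all_analysis.
From mathcomp Require Import ring lra.

Import Order.TTheory GRing.Theory Num.Theory.
Import numFieldNormedType.Exports.

Local Open Scope classical_set_scope.
Local Open Scope ring_scope.

(** * Common roots of a binary quadratic and a binary cubic form *)

Section BinaryForms.
Context {R : rcfType}.
Implicit Types a b c A B C E u v m : R.

Definition quad a b c u v := a * u ^+ 2 + 2 * b * u * v + c * v ^+ 2.

Definition cub A B C E u v :=
  A * u ^+ 3 + 3 * B * u ^+ 2 * v + 3 * C * u * v ^+ 2 + E * v ^+ 3.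

(** The resultant of [quad] and [cub], with its terms in the order of condition (3), so that the two
    agree by conversion. *)
Definition quad_cub_res a b c A B C E :=
  c ^+ 3 * A ^+ 2 + 6 * c * A * E * b * a - 6 * c ^+ 2 * A * C * a
  - 6 * E * b * a ^+ 2 * C + 9 * c * C ^+ 2 * a ^+ 2 - 6 * b * c ^+ 2 * B * A
  + 12 * b ^+ 2 * B * E * a - 18 * b * c * B * C * a
  + 12 * c * C * b ^+ 2 * A - 8 * E * b ^+ 3 * A + 9 * a * c ^+ 2 * B ^+ 2
  - 6 * c * B * E * a ^+ 2 + E ^+ 2 * a ^+ 3.

(** The quadratic formula for [quad a b c 1 m = 0], with [s] as the sign of the square root. Lemmas
    assume only [s ^+ 2 = 1] and so treat both roots at once. *)
Definition slope a b c s := (- b + s * Num.sqrt (b ^+ 2 - a * c)) / c.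

Lemma quad_slopes a b c s m : c != 0 -> 0 <= b ^+ 2 - a * c -> s ^+ 2 = 1 ->
  quad a b c 1 m = c * (m - slope a b c s) * (m - slope a b c (- s)).
Proof.
move=> c0 d0 s2; rewrite /slope; set d := Num.sqrt _.
have d2 : (s * d) ^+ 2 = b ^+ 2 - a * c by rewrite exprMn s2 mul1r sqr_sqrtr.
transitivity (((c * m + b) ^+ 2 - (s * d) ^+ 2) / c).
  by rewrite d2 /quad; field.
by field.
Qed.

Lemma quad_slope a b c s : c != 0 -> 0 <= b ^+ 2 - a * c -> s ^+ 2 = 1 ->
  quad a b c 1 (slope a b c s) = 0.
Proof. by move=> c0 d0 s2; rewrite (quad_slopes _ _ _ s)// subrr mulr0 mul0r. Qed.

(** Product formula for the resultant over the roots of the quadratic. Expressing [a] through the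
    square root [d] turns it into a rational identity in [d]. *)
Lemma quad_cub_res_slopes a b c A B C E : c != 0 -> 0 <= b ^+ 2 - a * c ->
  quad_cub_res a b c A B C E = c ^+ 3 * cub A B C E 1 (slope a b c 1)
    * cub A B C E 1 (slope a b c (-1)).
Proof.
move=> c0 d0; rewrite /slope; set d := Num.sqrt _.
have d2 : d ^+ 2 = b ^+ 2 - a * c by rewrite sqr_sqrtr.
have aE : a = (b ^+ 2 - d ^+ 2) / c by rewrite d2; field.
clearbody d; rewrite /cub /quad_cub_res aE; field; exact: c0.
Qed.

(** If the cubic vanishes at [n], this exhibits its factor [m - n] with a cofactor that is
    polynomial in all data. *)
Lemma cubB A B C E m n : cub A B C E 1 m - cub A B C E 1 n =
  (m - n) * (3 * B + 3 * C * (m + n) + E * (m ^+ 2 + m * n + n ^+ 2)).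
Proof. by rewrite /cub; ring. Qed.

Lemma quad_double_root a b c m : c != 0 -> b ^+ 2 = a * c ->
  quad a b c 1 m = c * (m + b / c) ^+ 2.
Proof.
move=> c0 ac; have -> : a = b ^+ 2 / c by rewrite ac mulfK.
by rewrite /quad; field.
Qed.

(** The last two hypotheses are the x- and y-derivatives of [b ^+ 2 = a * c] when [a], [b], [c] are
    the second derivatives of a function. They determine [A] and [B] from [C] and [E], and the cubic
    acquires the squared factor of the double root. *)
Lemma cub_double_root a b c A B C E m : c != 0 -> b ^+ 2 = a * c ->
  2 * b * B = a * C + c * A -> 2 * b * C = a * E + c * B ->
  cub A B C E 1 m =
  (m + b / c) ^+ 2 * (3 * (C - b / c * E) + (m + b / c) * E).
Proof.
move=> c0 ac hA hB.
have aE : a = b ^+ 2 / c by rewrite ac mulfK.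
have BE : B = (2 * b * C - a * E) / c by rewrite hB; field.
have AE : A = (2 * b * B - a * C) / c by rewrite hA; field.
by rewrite /cub AE BE aE; field.
Qed.

Lemma monic_cubic_root p q s : exists x : R, x ^+ 3 + p * x ^+ 2 + q * x + s = 0.
Proof.
pose P := ('X^3 + p *: 'X^2 + q *: 'X + s%:P) : {poly R}.
have PE x : P.[x] = x ^+ 3 + p * x ^+ 2 + q * x + s by rewrite !hornerE.
(* As [M] is at least 1, expanding one factor of [M ^+ 3] shows that the cube dominates the lower
   terms at [- M] and [M], so the intermediate value theorem applies. *)
pose M := 1 + `|p| + `|q| + `|s|.
have M1 : 1 <= M by rewrite /M -!addrA lerDl !addr_ge0.
have M0 : 0 <= M by rewrite (le_trans ler01).
have bnd x : `|x| = M -> `|p * x ^+ 2 + q * x + s| <= M ^+ 3.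
  move=> xM; rewrite (le_trans (ler_normD _ _))// (le_trans (lerD (ler_normD _ _) (lexx _)))//.
  rewrite !normrM xM -expr2.
  have -> : M ^+ 3 = M ^+ 2 + `|p| * M ^+ 2 + `|q| * M ^+ 2 + `|s| * M ^+ 2.
    by rewrite exprS {1}/M; ring.
  have M2 : M <= M ^+ 2 by rewrite expr2 ler_peMr.
  have M3 : 1 <= M ^+ 2 by rewrite (le_trans M1).
  have := ler_wpM2l (normr_ge0 q) M2; have := ler_wpM2l (normr_ge0 s) M3.
  by have := sqr_ge0 M; lra.
have [x _ /rootP] : exists2 x, - M <= x <= M & root P x.
  apply: poly_ivt; first lra.
  have := bnd M (ger0_norm M0); have := bnd (- M).
  rewrite normrN ger0_norm// !ler_norml => /(_ erefl)/andP[_ h1] /andP[h2 _].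
  rewrite !PE; apply/andP; split; [move: h1|move: h2];
    by rewrite ?(exprS (- M) 2) ?sqrrN ?(exprS M 2); lra.
by rewrite PE => x0; exists x.
Qed.

Lemma cub_root A B C E : exists u v, (u, v) <> (0, 0) /\ cub A B C E u v = 0.
Proof.
have [E0|E0] := eqVneq E 0.
  by exists 0, 1; split; [case=> /eqP; rewrite oner_eq0|rewrite /cub E0; ring].
have [x x0] := monic_cubic_root (3 * C / E) (3 * B / E) (A / E).
exists 1, x; split; first by case=> /eqP; rewrite oner_eq0.
by rewrite -[RHS](mulr0 E) -x0 /cub; field.
Qed.

(** With [u = 1] the roots are slopes, and the product formula decides. If [c = 0], the quadratic
    has the root [(0, 1)], which is not a slope, and the resultant is examined directly. *)
Lemma quad_cub_common_rootP a b c A B C E :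
  (exists u v, [/\ (u, v) <> (0, 0), quad a b c u v = 0 & cub A B C E u v = 0])
  <-> a * c - b ^+ 2 <= 0 /\ quad_cub_res a b c A B C E = 0.
Proof.
split.
  move=> [u [v [uv q k]]].
  have [u0|u0] := eqVneq u 0.
    have v0 : v != 0 by apply/eqP => v0; apply: uv; rewrite u0 v0.
    have c0 : c = 0.
      move/eqP: q; rewrite /quad u0 !(mulr0, mul0r, expr0n)/= !add0r mulf_eq0.
      by rewrite expf_eq0/= (negbTE v0) orbF => /eqP.
    have E0 : E = 0.
      move/eqP: k; rewrite /cub u0 !(mulr0, mul0r, expr0n)/= !add0r mulf_eq0.
      by rewrite expf_eq0/= (negbTE v0) orbF => /eqP.
    split; last by rewrite /quad_cub_res c0 E0; ring.
    by rewrite c0 mulr0 sub0r oppr_le0 sqr_ge0.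
  (* The two equations are linear in [a] and [A]. Eliminating these makes the resultant vanish
     identically and turns [a * c - b ^+ 2] into minus a square. *)
  pose m := v / u.
  have vE : v = m * u by rewrite /m divfK.
  have aE : a = - 2 * b * m - c * m ^+ 2.
    apply: (mulIf (expf_neq0 2 u0)); apply/eqP; rewrite -subr_eq0; apply/eqP.
    by rewrite -q /quad vE; ring.
  have AE : A = - 3 * B * m - 3 * C * m ^+ 2 - E * m ^+ 3.
    apply: (mulIf (expf_neq0 3 u0)); apply/eqP; rewrite -subr_eq0; apply/eqP.
    by rewrite -k /cub vE; ring.
  split; last by rewrite /quad_cub_res aE AE; ring.
  rewrite (_ : _ - _ = - (c * m + b) ^+ 2) ?oppr_le0 ?sqr_ge0//.
  by rewrite aE; ring.
move=> [d0 r0].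
(* For [c = 0] the quadratic is [u * (a * u + 2 * b * v)], with roots [(0, 1)] and [(-2 * b, a)],
   and the resultant is [E] times the cubic at [(-2 * b, a)]. If also [a = b = 0], any root of the
   cubic will do. *)
have [c0|c0] := eqVneq c 0.
  have [E0|E0] := eqVneq E 0.
    exists 0, 1; split; [by case=> /eqP; rewrite oner_eq0| |].
      by rewrite /quad c0; ring.
    by rewrite /cub E0; ring.
  have [a0|a0] := eqVneq a 0.
    have [b0|b0] := eqVneq b 0.
      have [u [v [uv k]]] := cub_root A B C E.
      by exists u, v; split=> //; rewrite /quad a0 b0 c0; ring.
    exists 1, 0; split; [by case=> /eqP; rewrite oner_eq0| |].
      by rewrite /quad a0; ring.
    have n0 : (-8) * E * b ^+ 3 != 0.
      by rewrite !mulf_neq0 ?expf_neq0// oppr_eq0 pnatr_eq0.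
    have -> : A = 0.
      by apply: (mulfI n0); rewrite mulr0 -r0 /quad_cub_res c0 a0; ring.
    by rewrite /cub; ring.
  exists (-2 * b), a; split.
  - by case=> _ /eqP; rewrite (negbTE a0).
  - by rewrite /quad c0; ring.
  - apply: (mulfI E0); rewrite mulr0 -r0 /cub /quad_cub_res c0; ring.
have d1 : 0 <= b ^+ 2 - a * c by rewrite -oppr_le0 opprB.
move: r0; rewrite quad_cub_res_slopes//.
move/eqP; rewrite mulf_eq0 mulf_eq0 (negbTE (expf_neq0 3 c0)) => /orP[|] /eqP k.
- exists 1, (slope a b c 1); split=> //; [by case=> /eqP; rewrite oner_eq0|].
  by apply: quad_slope => //; rewrite expr1n.
- exists 1, (slope a b c (-1)); split=> //; [by case=> /eqP; rewrite oner_eq0|].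
  by apply: quad_slope => //; rewrite sqrrN expr1n.
Qed.

End BinaryForms.

(** * Directional derivatives and their symmetry in a normed space *)

Section DirectionalDerivatives.
Context {R : realType} {V : normedModType R}.
Implicit Types (f : V -> R) (p q a b v : V) (D : set V).

Lemma is_derive_line f p v (t : R) : derivable f (p + t *: v) v ->
  is_derive t 1 (fun s : R => f (p + s *: v)) ('D_v f (p + t *: v)).
Proof.
move=> df.
have E : (fun h : R => h^-1 *: (f (p + (h *: 1 + t) *: v) - f (p + t *: v))) =
         (fun h : R => h^-1 *: (f (h *: v + (p + t *: v)) - f (p + t *: v))).
  apply/funext => h; congr (_ *: (f _ - _)).
  by rewrite [h *: 1]mulr1 scalerDl addrCA.
by split; [rewrite /derivable|rewrite /derive]; rewrite /= E.
Qed.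

Lemma is_derive_line_scale f p v (s t : R) : derivable f (p + (t * s) *: v) v ->
  is_derive t 1 (fun x : R => f (p + (x * s) *: v)) (s * 'D_v f (p + (t * s) *: v)).
Proof.
move=> /is_derive_line df.
have sc : is_derive t (1 : R) (fun x : R => x * s) s.
  by apply: is_derive_eq; rewrite scaler0 add0r [s *: 1]mulr1.
apply: is_derive_eq; last exact: mulrC.
exact: (@is_derive1_comp _ (fun x => f (p + x *: v)) (fun x => x * s)).
Qed.

(** Running [t] over the unit interval and scaling by [s] covers both signs of [s]. *)
Lemma MVT_line f p v (s : R) :
  (forall t : R, 0 <= t <= 1 -> derivable f (p + (t * s) *: v) v) ->
  exists2 t : R, 0 <= t <= 1 & f (p + s *: v) - f p = s * 'D_v f (p + (t * s) *: v).
Proof.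
move=> df.
pose phi (t : R) := f (p + (t * s) *: v).
have dphi (t : R) : 0 <= t <= 1 -> is_derive t 1 phi (s * 'D_v f (p + (t * s) *: v)).
  by move=> /df/is_derive_line_scale.
have [||t t01] := @MVT_segment R phi (fun t => s * 'D_v f (p + (t * s) *: v)) 0 1 ler01.
- by move=> t; rewrite in_itv/= => /andP[/ltW t0 /ltW t1]; apply: dphi; rewrite t0 t1.
- by apply: derivable_within_continuous => t; rewrite in_itv/= => /dphi[].
- by rewrite /phi mul1r mul0r scale0r addr0 subr0 mulr1 => ->; exists t; rewrite -?(itvP t01).
Qed.

Lemma open_ball_parallelogram D p a b : open D -> D p ->
  exists2 d : R, 0 < d & forall k l : R, `|k| < d -> `|l| < d -> D (p + k *: a + l *: b).
Proof.
move=> oD Dp.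
have /nbhs_ballP[e /= e0 eD] : nbhs p D by apply: open_nbhs_nbhs.
have ab0 : 0 < `|a| + `|b| + 1 by rewrite ltr_wpDl// addr_ge0.
(* The summand 1 keeps the denominator positive when [a = b = 0] and makes the final estimate
   strict. *)
exists (e / (`|a| + `|b| + 1)); first by rewrite divr_gt0.
move=> k l kd ld; apply: eD; rewrite -ball_normE/= -addrA opprD addNKr normrN.
rewrite (le_lt_trans (ler_normD _ _))// !normrZ.
move: kd ld; rewrite !ltr_pdivlMr// => kd ld.
have h1 : `|k| * `|a| <= e / (`|a| + `|b| + 1) * `|a|.
  by rewrite ler_wpM2r// ler_pdivlMr// ltW.
have h2 : `|l| * `|b| <= e / (`|a| + `|b| + 1) * `|b|.
  by rewrite ler_wpM2r// ler_pdivlMr// ltW.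
rewrite (le_lt_trans (lerD h1 h2))// -mulrDr -mulrA gtr_pMr// mulrC.
by rewrite ltr_pdivrMr// mul1r ltrDl.
Qed.

(** The increment is split into a step along [b] followed by a step along [a]. The mean value
    theorem applies to each, and continuity of the two derivatives at [p] gives the limit. *)
Lemma is_derive_lincomb D f p a b (u v : R) : open D -> D p ->
  (forall q, D q -> derivable f q a) -> (forall q, D q -> derivable f q b) ->
  {for p, continuous ('D_a f)} -> {for p, continuous ('D_b f)} ->
  is_derive p (u *: a + v *: b) f (u * 'D_a f p + v * 'D_b f p).
Proof.
move=> oD Dp fa fb ca cb.
have cv : h^-1 *: (f (h *: (u *: a + v *: b) + p) - f p) @[h --> 0^'] -->
    u * 'D_a f p + v * 'D_b f p.
  apply/cvgrPdist_lt => e e0.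
  (* [m] exceeds [|u| + |v|], so errors below [e / m] in the two derivatives contribute less than
     [e] in total. *)
  pose m := `|u| + `|v| + 1.
  have m0 : 0 < m by rewrite ltr_wpDl// addr_ge0.
  have em0 : 0 < e / m by rewrite divr_gt0.
  pose G := D `&` [set q | `|'D_a f p - 'D_a f q| < e / m] `&`
            [set q | `|'D_b f p - 'D_b f q| < e / m].
  have nG : nbhs p G.
    apply: filterI; first apply: filterI; first exact: open_nbhs_nbhs.
    - by move/cvgrPdist_lt : ca; apply.
    - by move/cvgrPdist_lt : cb; apply.
  have [d d0 dG] : exists2 d : R, 0 < d &
      forall k l : R, `|k| < d -> `|l| < d -> G (p + k *: b + l *: a).
    have [d d0 dG] := @open_ball_parallelogram G° p b a (open_interior _) nG.
    by exists d => // k l kd ld; apply: interior_subset; apply: dG.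
  near=> h.
  have h0 : h != 0 by near: h; exact: nbhs_dnbhs_neq.
  have hd : `|h| < d / m by near: h; apply: dnbhs0_lt; rewrite divr_gt0.
  have hk (k w : R) : `|k| <= 1 -> `|w| <= m -> `|k * (h * w)| < d.
    move=> k1 wm; rewrite !normrM (@le_lt_trans _ _ (`|h| * m))//.
      rewrite mulrCA ler_wpM2l// -[leRHS]mul1r ler_pM//.
    by rewrite -ltr_pdivlMr.
  have um : `|u| <= m by rewrite /m -addrA lerDl addr_ge0.
  have vm : `|v| <= m by rewrite /m addrAC lerDr addr_ge0.
  have hvd : `|h * v| < d by rewrite -[h * v]mul1r hk ?normr1.
  have i01 (t : R) : 0 <= t <= 1 -> `|t| <= 1 by move=> /andP[t0 ?]; rewrite ger0_norm.
  have [t1 t1i E1] := @MVT_line f (p + (h * v) *: b) a (h * u)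
    (fun t ti => fa _ (dG _ _ hvd (hk t u (i01 _ ti) um)).1.1).
  have Gb (t : R) : 0 <= t <= 1 -> G (p + (t * (h * v)) *: b).
    move=> ti; have := dG _ 0 (hk t v (i01 _ ti) vm).
    by rewrite scale0r addr0 normr0 => /(_ d0).
  have [t2 t2i E2] := @MVT_line f p b (h * v) (fun t ti => fb _ (Gb t ti).1.1).
  have -> : h *: (u *: a + v *: b) + p = p + (h * v) *: b + (h * u) *: a.
    by rewrite scalerDr !scalerA addrC [X in _ + X]addrC addrA.
  have -> : h^-1 *: (f (p + (h * v) *: b + (h * u) *: a) - f p) =
      u * 'D_a f (p + (h * v) *: b + (t1 * (h * u)) *: a)
      + v * 'D_b f (p + (t2 * (h * v)) *: b).
    have -> : f (p + (h * v) *: b + (h * u) *: a) - f p =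
      (f (p + (h * v) *: b + (h * u) *: a) - f (p + (h * v) *: b)) +
      (f (p + (h * v) *: b) - f p) by ring.
    by rewrite E1 E2 [LHS]mulrC; field.
  have [[_ /= A1] _] := dG _ (t1 * (h * u)) hvd (hk t1 u (i01 _ t1i) um).
  have [_ A2] := Gb t2 t2i.
  move: A1 A2 => /=; set x := 'D_a f _; set y := 'D_a f _.
  set z := 'D_b f _; set w := 'D_b f _ => A1 A2.
  have -> : u * x + v * z - (u * y + v * w) = u * (x - y) + v * (z - w) by ring.
  rewrite (le_lt_trans (ler_normD _ _))// !normrM.
  rewrite (@le_lt_trans _ _ (`|u| * (e / m) + `|v| * (e / m)))//.
    by rewrite lerD// ler_wpM2l// ltW.
  by rewrite -mulrDl mulrCA gtr_pMr// ltr_pdivrMr// mul1r ltrDl.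
split; first by apply/cvg_ex; eexists; exact: cv.
exact: cvg_lim cv.
Unshelve. all: by end_near. Qed.

(** Mean value theorem twice: along [a] for the difference of [f] across [h *: b], then along [b]
    for ['D_a f]. *)
Lemma second_difference D f p a b (h : R) :
  (forall q, D q -> derivable f q a) ->
  (forall q, D q -> derivable ('D_a f) q b) ->
  (forall k l : R, 0 <= k <= 1 -> 0 <= l <= 1 -> D (p + (k * h) *: a + (l * h) *: b)) ->
  exists k l : R, [/\ 0 <= k <= 1, 0 <= l <= 1 &
    f (p + h *: a + h *: b) - f (p + h *: a) - f (p + h *: b) + f p =
    h ^+ 2 * 'D_b ('D_a f) (p + (k * h) *: a + (l * h) *: b)].
Proof.
move=> fa fab Dh.
have i0 : 0 <= (0 : R) <= 1 by rewrite lexx ler01.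
have i1 : 0 <= (1 : R) <= 1 by rewrite lexx ler01.
pose phi (t : R) := f (p + h *: b + (t * h) *: a) - f (p + (t * h) *: a).
pose dphi (t : R) := h * 'D_a f (p + h *: b + (t * h) *: a) - h * 'D_a f (p + (t * h) *: a).
have Dphi (t : R) : 0 <= t <= 1 -> is_derive t 1 phi (dphi t).
  move=> ti; apply: is_deriveB; apply: is_derive_line_scale; apply: fa.
  - by have := Dh t 1 ti i1; rewrite mul1r addrAC.
  - by have := Dh t 0 ti i0; rewrite mul0r scale0r addr0.
have [||k ki] := @MVT_segment R phi dphi 0 1 ler01.
- by move=> t; rewrite in_itv/= => /andP[/ltW t0 /ltW t1]; apply: Dphi; rewrite t0 t1.
- by apply: derivable_within_continuous => t; rewrite in_itv/= => /Dphi[].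
rewrite in_itv/= in ki.
have [l li] := @MVT_line ('D_a f) (p + (k * h) *: a) b h (fun t ti => fab _ (Dh k t ki ti)).
rewrite /phi /dphi !mul1r !mul0r !scale0r !addr0 subr0 mulr1 -mulrBr => El Ek.
exists k, l; split=> //.
rewrite expr2 -mulrA -El [p + (k * h) *: a + _]addrAC -Ek.
by rewrite [p + h *: b + h *: a]addrAC; ring.
Qed.

(** Schwarz's argument: the second difference is symmetric in [a] and [b], so it is [h ^+ 2] times a
    value near [p] of either mixed derivative, and both are continuous at [p]. *)
Lemma deriveC D f p a b : open D -> D p ->
  (forall q, D q -> derivable f q a) -> (forall q, D q -> derivable f q b) ->
  (forall q, D q -> derivable ('D_a f) q b) ->
  (forall q, D q -> derivable ('D_b f) q a) ->
  {for p, continuous ('D_b ('D_a f))} -> {for p, continuous ('D_a ('D_b f))} ->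
  'D_b ('D_a f) p = 'D_a ('D_b f) p.
Proof.
move=> oD Dp fa fb fab fba cab cba.
apply/eqP; rewrite -subr_eq0 -normr_le0; apply/ler_addgt0Pr => e e0.
have e20 : 0 < e / 2 by rewrite divr_gt0.
pose G := D `&` [set q | `|'D_b ('D_a f) p - 'D_b ('D_a f) q| < e / 2] `&`
          [set q | `|'D_a ('D_b f) p - 'D_a ('D_b f) q| < e / 2].
have nG : nbhs p G.
  apply: filterI; first apply: filterI; first exact: open_nbhs_nbhs.
  - by move/cvgrPdist_lt : cab; apply.
  - by move/cvgrPdist_lt : cba; apply.
have [d d0 dG] := @open_ball_parallelogram G° p a b (open_interior _) nG.
have {}dG (k l : R) : `|k| < d -> `|l| < d -> G (p + k *: a + l *: b).
  by move=> kd ld; apply: interior_subset; apply: dG.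
pose h := d / 2.
have h0 : 0 < h by rewrite divr_gt0.
have hd (k : R) : 0 <= k <= 1 -> `|k * h| < d.
  move=> /andP[k0 k1]; rewrite ger0_norm; last exact: mulr_ge0 k0 (ltW h0).
  apply: (@le_lt_trans _ _ h); first exact: ler_piMl (ltW h0) k1.
  by rewrite /h; lra.
have Gab (k l : R) : 0 <= k <= 1 -> 0 <= l <= 1 ->
    G (p + (k * h) *: a + (l * h) *: b).
  by move=> ki li; apply: dG; exact: hd.
have Dba (k l : R) : 0 <= k <= 1 -> 0 <= l <= 1 ->
    D (p + (k * h) *: b + (l * h) *: a).
  by move=> ki li; rewrite addrAC; exact: (Gab _ _ li ki).1.1.
have [k [l [ki li E1]]] := @second_difference D f p a b h fa fab
  (fun k l ki li => (Gab k l ki li).1.1).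
have [l' [k' [li' ki' E2]]] := @second_difference D f p b a h fb fba Dba.
have [[_ /= A1] _] := Gab _ _ ki li.
have [_ /= A2] : G (p + (l' * h) *: b + (k' * h) *: a).
  by rewrite addrAC; exact: Gab.
have E : f (p + h *: a + h *: b) - f (p + h *: a) - f (p + h *: b) + f p =
         f (p + h *: b + h *: a) - f (p + h *: b) - f (p + h *: a) + f p.
  by rewrite (addrAC p (h *: b)); congr (_ + _); exact: addrAC.
have {E1 E2 E} := etrans (esym E1) (etrans E E2).
move=> /(mulfI (expf_neq0 2 (lt0r_neq0 h0))).
have close (x y z w : R) :
    `|x - y| < e / 2 -> `|z - w| < e / 2 -> y = w -> `|x - z| <= 0 + e.
  move=> xy zw yw; rewrite add0r [e]splitr -(subrK y x) -addrA {2}yw.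
  by rewrite (le_trans (ler_normD _ _))// lerD// ltW// distrC.
by move=> E; exact: close A1 A2 E.
Qed.

(** Leibniz rule on both sides of an identity valid near [p]; it serves to differentiate
    [fxy ^+ 2 = fxx * fyy]. *)
Lemma derive_sqr_eq_mul D f g h p v : open D -> D p ->
  (forall q, D q -> f q ^+ 2 = g q * h q) ->
  derivable f p v -> derivable g p v -> derivable h p v ->
  2 * f p * 'D_v f p = g p * 'D_v h p + h p * 'D_v g p.
Proof.
move=> oD Dp fgh df dg dh.
have : 'D_v (f * f) p = 'D_v (g * h) p.
  apply: near_eq_derive; have : nbhs p D by exact: open_nbhs_nbhs.
  by apply: filterS => q /fgh.
rewrite (deriveM df df) (deriveM dg dh) => <-.
by rewrite -mulrA mulr_natl mulr2n.
Qed.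

End DirectionalDerivatives.

(** * Functions of one real variable on a symmetric interval *)

Section OneVariable.
Context {R : realType}.
Implicit Types (g h : R -> R) (e t : R).

(** The interval is a neighbourhood of [t]. This allows an identity along a segment to be
    differentiated repeatedly. *)
Lemma is_derive_unique_oo e t g h (a b : R) : `|t| < e ->
  (forall s, `|s| < e -> g s = h s) ->
  is_derive t 1 g a -> is_derive t 1 h b -> a = b.
Proof.
move=> te gh dg dh.
suff : is_derive t 1 h a by move=> [_ <-]; case: dh.
apply: near_eq_is_derive dg.
have : nbhs t [set s | `|s| < e].
  by have /cvgr_lt := @norm_continuous _ _ t; apply.
by apply: filterS => s; exact: gh.
Qed.

Lemma MVT0 g (s : R) : (forall t, `|t| <= `|s| -> derivable g t 1) ->
  exists2 t, `|t| <= `|s| & g s - g 0 = s * 'D_1 g t.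
Proof.
move=> dg; have lineE (t : R) : 0 + t *: 1 = t by rewrite add0r [t *: 1]mulr1.
have ts (t : R) : 0 <= t <= 1 -> `|t * s| <= `|s|.
  by move=> /andP[t0 t1]; rewrite normrM (ger0_norm t0) ler_piMl.
have [|t t01] := @MVT_line R R g 0 1 s.
  by move=> t /ts; rewrite lineE; exact: dg.
by rewrite !lineE => gE; exists (t * s); rewrite ?ts.
Qed.

Lemma derive0_cst_oo e g : (forall t, `|t| < e -> is_derive t 1 g 0) ->
  forall t, `|t| < e -> g t = g 0.
Proof.
move=> dg t te; have [s st|s st] := @MVT0 g t.
  by have [] := dg s (le_lt_trans st te).
have [_ ->] := dg s (le_lt_trans st te).
by rewrite mulr0 => /eqP; rewrite subr_eq0 => /eqP.
Qed.

Lemma is_derive_lincomb1 t g h (a b u v : R) :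
  is_derive t 1 g a -> is_derive t 1 h b ->
  is_derive t 1 (fun s => u * g s + v * h s) (u * a + v * b).
Proof.
by move=> dg dh; exact: (is_deriveD (is_deriveZ u dg) (is_deriveZ v dh)).
Qed.

Lemma is_derive_affine t (a w : R) : is_derive t 1 (fun s => a + w * s) w.
Proof.
have := is_deriveD (is_derive_cst a t 1) (is_deriveZ w (is_derive_id t 1)).
by rewrite add0r [_ *: _]mulr1.
Qed.

(* The maximum of [`|h|] on the interval is at most [M * e < 1] times itself. *)
Lemma gronwall0 e (M : R) h dh : 0 <= M -> M * e < 1 -> h 0 = 0 ->
  (forall t, `|t| <= e -> is_derive t 1 h (dh t)) ->
  (forall t, `|t| <= e -> `|dh t| <= M * `|h t|) ->
  forall t, `|t| <= e -> h t = 0.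
Proof.
move=> M0 Me h0 Dh dhM t te.
have e0 : 0 <= e by rewrite (le_trans _ te).
have itvE x : (x \in `[- e, e]%R) = (`|x| <= e) by rewrite in_itv/= ler_norml.
have hc : {within `[- e, e], continuous (fun x => `|h x|)}.
  move=> x; apply: continuous_comp; last exact: norm_continuous.
  move: x; apply: (@derivable_within_continuous _ _ h) => x.
  by rewrite itvE => /Dh[].
have [|x xe hmax] := EVT_max _ hc; first by rewrite ge0_cp.
rewrite itvE in xe.
have [s sx|s sx] := @MVT0 h x; first by have [] := Dh s (le_trans sx xe).
have [_ ->] := Dh s (le_trans sx xe).
rewrite h0 subr0 => hx.
have hx0 : `|h x| <= 0.
  have hs : `|h s| <= `|h x| by apply: hmax; rewrite itvE (le_trans sx).
  have : `|h x| <= M * e * `|h x|.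
    rewrite {1}hx normrM mulrC (mulrAC M) ler_pM// (le_trans (dhM _ (le_trans sx xe)))//.
    by rewrite ler_wpM2l.
  have := normr_ge0 (h x); nra.
apply/eqP; rewrite -normr_le0 (le_trans _ hx0)//.
by apply: hmax; rewrite itvE.
Qed.

End OneVariable.

(** * Restrictions of a C^3 function to lines, and segments on its graph *)

Section C3Lines.
Context {R : realType}.
Implicit Types (D : set (R * R)) (f g : R * R -> R) (p : R * R) (t u v : R).

Lemma C_S k D f : C_ k.+1 D f -> C_ k D f.
Proof.
elim: k f => [|k IH] f [cf fxy]; split; try exact: cf; first exact: I.
by case: fxy => fx fy /IH Cx /IH Cy; split.
Qed.

Lemma C_continuous k D f p : C_ k D f -> D p -> {for p, continuous f}.
Proof. by case: k => [|k] [cf _]; exact: cf. Qed.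

Lemma C_dx k D f : C_ k.+1 D f -> C_ k D (dx f).
Proof. by move=> [_ []]. Qed.

Lemma C_dy k D f : C_ k.+1 D f -> C_ k D (dy f).
Proof. by move=> [_ []]. Qed.

Lemma pair_lincomb u v : (u, v) = u *: (1, 0) + v *: (0, 1) :> R * R.
Proof.
have -> : u *: (1, 0) + v *: (0, 1) = (u * 1 + v * 0, u * 0 + v * 1) :> R * R by [].
by rewrite !mulr0 !mulr1 addr0 add0r.
Qed.

Lemma is_derive_C1 D f p u v : open D -> C_ 1 D f -> D p ->
  is_derive p (u, v) f (u * dx f p + v * dy f p).
Proof.
move=> oD [cf [fx fy [cx _] [cy _]]] Dp; rewrite (pair_lincomb u v).
exact: (is_derive_lincomb _ _ _ _ _ u v oD Dp fx fy (cx p Dp) (cy p Dp)).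
Qed.

Lemma dxdyC D f p : open D -> C_ 2 D f -> D p -> dx (dy f) p = dy (dx f) p.
Proof.
move=> oD [cf [fx fy [_ [_ fxy _ Cxy]] [_ [fyx _ Cyx _]]]] Dp; symmetry.
exact: (deriveC _ _ _ _ _ oD Dp fx fy fxy fyx (Cxy.1 p Dp) (Cyx.1 p Dp)).
Qed.

(** Two swaps bring the x-derivative innermost, the order used for [fxyy]. The second swap takes
    place under [dy], hence needs the symmetry on a neighbourhood of [p]. *)
Lemma dxdydy D f p : open D -> C_ 3 D f -> D p ->
  dx (dy (dy f)) p = dy (dy (dx f)) p.
Proof.
move=> oD C3 Dp; rewrite (dxdyC D (dy f) p oD (C_dy _ _ _ C3) Dp).
apply: near_eq_derive; have : nbhs p D by exact: open_nbhs_nbhs.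
by apply: filterS => q Dq; apply: (dxdyC D f q oD (C_S _ _ _ C3) Dq).
Qed.

Lemma C_derivable k D f p : C_ k.+1 D f -> D p ->
  derivable f p ((1, 0) : R * R) /\ derivable f p ((0, 1) : R * R).
Proof. by move=> [_ [fx fy _ _]] Dp; split; [exact: fx|exact: fy]. Qed.

(** The x- and y-derivatives of the discriminant equation, with mixed derivatives reordered to match
    the hypotheses of [cub_double_root]. *)
Lemma degenerate_D2_derive D V f p : open D -> C_ 3 D f -> open V -> V `<=` D ->
  V p -> (forall q, V q -> dy (dx f) q ^+ 2 = dx (dx f) q * dy (dy f) q) ->
  2 * dy (dx f) p * dy (dx (dx f)) p =
    dx (dx f) p * dy (dy (dx f)) p + dy (dy f) p * dx (dx (dx f)) p /\
  2 * dy (dx f) p * dy (dy (dx f)) p =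
    dx (dx f) p * dy (dy (dy f)) p + dy (dy f) p * dy (dx (dx f)) p.
Proof.
move=> oD C3 oV VD Vp disc0; have Dp := VD p Vp.
have Cx := C_dx _ _ _ C3; have Cy := C_dy _ _ _ C3.
have [ax ay] := C_derivable _ _ _ _ (C_dx _ _ _ Cx) Dp.
have [bx b_y] := C_derivable _ _ _ _ (C_dy _ _ _ Cx) Dp.
have [cx cy] := C_derivable _ _ _ _ (C_dy _ _ _ Cy) Dp.
split; last exact: (derive_sqr_eq_mul _ _ _ _ _ _ oV Vp disc0 b_y ay cy).
have H := derive_sqr_eq_mul _ _ _ _ _ _ oV Vp disc0 bx ax cx.
have bE : 'D_(1, 0) (dy (dx f)) p = dy (dx (dx f)) p := dxdyC _ _ _ oD Cx Dp.
have cE : 'D_(1, 0) (dy (dy f)) p = dy (dy (dx f)) p := dxdydy _ _ _ oD C3 Dp.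
exact: (etrans (congr1 (fun x => 2 * dy (dx f) p * x) (esym bE))
  (etrans H (congr1 (fun y => dx (dx f) p * y + dy (dy f) p * _) cE))).
Qed.

(* Keeps unification from comparing the directions [(1, 0)] and [(0, 1)]. *)
#[local] Opaque dx dy.

Lemma is_derive_C1_line D f p u v t : open D -> C_ 1 D f ->
  D (p + t *: (u, v)) ->
  is_derive t 1 (fun s => f (p + s *: (u, v)))
    (u * dx f (p + t *: (u, v)) + v * dy f (p + t *: (u, v))).
Proof.
move=> oD C1 Dt; have [df dfE] := is_derive_C1 D f _ u v oD C1 Dt.
by rewrite -dfE; exact: is_derive_line.
Qed.

(** Second derivative of [f] along the constant direction [(u, v)]; [D3] is the third. *)
Definition D2 f p u v := quad (dx (dx f) p) (dy (dx f) p) (dy (dy f) p) u v.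

Definition D3 f p u v := cub (dx (dx (dx f)) p) (dy (dx (dx f)) p)
  (dy (dy (dx f)) p) (dy (dy (dy f)) p) u v.

Lemma is_derive_D2 D f p u v t : open D -> C_ 2 D f -> D (p + t *: (u, v)) ->
  is_derive t 1 (fun s => u * dx f (p + s *: (u, v)) + v * dy f (p + s *: (u, v)))
    (D2 f (p + t *: (u, v)) u v).
Proof.
move=> oD C2 Dt.
have Dx := is_derive_C1_line D _ p u v t oD (C_dx _ _ _ C2) Dt.
have Dy := is_derive_C1_line D _ p u v t oD (C_dy _ _ _ C2) Dt.
have := is_derive_lincomb1 t _ _ _ _ u v Dx Dy.
rewrite (dxdyC D f _ oD C2 Dt) /D2 /quad; set a := dx _ _; set b := dy _ _.
by set c := dy _ _ => dD; apply: is_derive_eq dD _; ring.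
Qed.

(** This and the next identity match the nested form that two uses of [is_derive_lincomb1]
    produce. *)
Lemma quad_linear_sum (a b c u v : R) :
  quad a b c u v = 1 * (u ^+ 2 * a + 2 * u * v * b) + v ^+ 2 * c.
Proof. by rewrite /quad; ring. Qed.

Lemma cub_linear_sum (A B C E u v : R) :
  1 * (u ^+ 2 * (u * A + v * B) + 2 * u * v * (u * B + v * C))
  + v ^+ 2 * (u * C + v * E) = cub A B C E u v.
Proof. by rewrite /cub; ring. Qed.

Lemma is_derive_D3 D f p u v t : open D -> C_ 3 D f -> D (p + t *: (u, v)) ->
  is_derive t 1 (fun s => D2 f (p + s *: (u, v)) u v)
    (D3 f (p + t *: (u, v)) u v).
Proof.
move=> oD C3 Dt.
have Cx := C_dx _ _ _ C3; have Cy := C_dy _ _ _ C3.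
have Dxx := is_derive_C1_line D _ p u v t oD (C_dx _ _ _ Cx) Dt.
have Dxy : is_derive t 1 (fun s => dy (dx f) (p + s *: (u, v)))
    (u * dy (dx (dx f)) (p + t *: (u, v)) + v * dy (dy (dx f)) (p + t *: (u, v))).
  apply: is_derive_eq (is_derive_C1_line D _ p u v t oD (C_dy _ _ _ Cx) Dt) _.
  exact: (congr1 (fun x => u * x + v * _) (dxdyC _ _ _ oD Cx Dt)).
have Dyy : is_derive t 1 (fun s => dy (dy f) (p + s *: (u, v)))
    (u * dy (dy (dx f)) (p + t *: (u, v)) + v * dy (dy (dy f)) (p + t *: (u, v))).
  apply: is_derive_eq (is_derive_C1_line D _ p u v t oD (C_dy _ _ _ Cy) Dt) _.
  exact: (congr1 (fun x => u * x + v * _) (dxdydy _ _ _ oD C3 Dt)).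
have dD := is_derive_lincomb1 t _ _ _ _ 1 (v ^+ 2)
  (is_derive_lincomb1 t _ _ _ _ (u ^+ 2) (2 * u * v) Dxx Dxy) Dyy.
have -> : (fun s => D2 f (p + s *: (u, v)) u v) =
  fun s => 1 * (u ^+ 2 * dx (dx f) (p + s *: (u, v)) +
    2 * u * v * dy (dx f) (p + s *: (u, v))) +
    v ^+ 2 * dy (dy f) (p + s *: (u, v)).
  by apply/funext => s; exact: quad_linear_sum.
exact: (is_derive_eq dD (cub_linear_sum _ _ _ _ _ _)).
Qed.

Lemma open_line D p a : open D -> D p ->
  exists2 e, 0 < e & forall t, `|t| < e -> D (p + t *: a).
Proof.
move=> oD Dp; have [e e0 De] := open_ball_parallelogram D p a 0 oD Dp.
by exists e => // t te; have := De t 0 te; rewrite scale0r addr0 normr0; exact.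
Qed.

Lemma affine_line_D2_D3 D f p u v (w e : R) : open D -> C_ 3 D f -> 0 < e ->
  (forall t, `|t| < e -> D (p + t *: (u, v)) /\ f (p + t *: (u, v)) = f p + w * t) ->
  D2 f p u v = 0 /\ D3 f p u v = 0.
Proof.
move=> oD C3 e0 fe; have C2 := C_S _ _ _ C3; have C1 := C_S _ _ _ C2.
have E1 t : `|t| < e -> u * dx f (p + t *: (u, v)) + v * dy f (p + t *: (u, v)) = w.
  move=> te.
  exact: (is_derive_unique_oo e t _ _ _ _ te (fun s se => (fe s se).2)
    (is_derive_C1_line D f p u v t oD C1 (fe t te).1) (is_derive_affine t (f p) w)).
have E2 t : `|t| < e -> D2 f (p + t *: (u, v)) u v = 0.
  move=> te; exact: (is_derive_unique_oo e t _ _ _ _ te E1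
    (is_derive_D2 D f p u v t oD C2 (fe t te).1) (is_derive_cst w t 1)).
have E3 t : `|t| < e -> D3 f (p + t *: (u, v)) u v = 0.
  move=> te; exact: (is_derive_unique_oo e t _ _ _ _ te E2
    (is_derive_D3 D f p u v t oD C3 (fe t te).1) (is_derive_cst 0 t 1)).
by have := E2 0; have := E3 0; rewrite scale0r addr0 normr0 => ->// ->.
Qed.

Lemma D2_line_affine D f p u v (e : R) : open D -> C_ 2 D f ->
  (forall t, `|t| < e -> D (p + t *: (u, v)) /\ D2 f (p + t *: (u, v)) u v = 0) ->
  forall t, `|t| < e -> f (p + t *: (u, v)) = f p + (u * dx f p + v * dy f p) * t.
Proof.
move=> oD C2 fe t te; set w := u * _ + _.
have dD (s : R) : `|s| < e -> is_derive s 1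
    (fun s => u * dx f (p + s *: (u, v)) + v * dy f (p + s *: (u, v))) 0.
  move=> se; have [Ds d0] := fe s se.
  exact: (is_derive_eq (is_derive_D2 D f p u v s oD C2 Ds) d0).
have E1 (s : R) : `|s| < e -> u * dx f (p + s *: (u, v)) + v * dy f (p + s *: (u, v)) = w.
  by move=> /(derive0_cst_oo _ _ dD) ->; rewrite scale0r addr0.
(* [f] on the line minus the linear function [w * s] has zero derivative; the [0 +] fits
   [is_derive_affine]. *)
have dF (s : R) : `|s| < e ->
    is_derive s 1 (fun s => 1 * f (p + s *: (u, v)) + (-1) * (0 + w * s)) 0.
  move=> se; have Ds := (fe s se).1.
  have dl := is_derive_C1_line D f p u v s oD (C_S _ _ _ C2) Ds.
  apply: is_derive_eq (is_derive_lincomb1 s _ _ _ _ 1 (-1) dl (is_derive_affine s 0 w)) _.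
  by rewrite E1// mul1r mulN1r subrr.
have := derive0_cst_oo _ _ dF t te; rewrite scale0r addr0 mulr0.
by move=> /eqP; rewrite !mul1r !mulN1r !add0r oppr0 addr0 subr_eq => /eqP.
Qed.

(** The property that condition (1) asks of a generic point, kept literal so that the two agree by
    conversion. *)
Definition segment_at D f p := exists S : set (R * R * R),
  line_segment_through (p, f p) S /\ S `<=` graph D f.

Lemma lineE p u v t : p + t *: (u, v) = (p.1 + u * t, p.2 + v * t).
Proof. by rewrite mulrC (mulrC v). Qed.

Lemma segment_at_D2_D3 D f p : open D -> C_ 3 D f -> segment_at D f p ->
  exists u v, [/\ (u, v) <> (0, 0), D2 f p u v = 0 & D3 f p u v = 0].
Proof.
move=> oD C3 [S [[u [v [w [e [uvw e0 ->]]]]] Sf]].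
have fe t : `|t| < e -> D (p + t *: (u, v)) /\ f (p + t *: (u, v)) = f p + w * t.
  move=> te; rewrite lineE.
  have [] := Sf (p.1 + u * t, p.2 + v * t, f p + w * t); last by [].
  by exists t => //=; rewrite in_itv/= -ltr_norml.
exists u, v; have [d2 d3] := affine_line_D2_D3 D f p u v w e oD C3 e0 fe.
(* If [u = v = 0], the segment is vertical. Its point at parameter [e / 2] lies on the graph above
   [p], which forces [w = 0] and contradicts nondegeneracy. *)
split=> // -[u0 v0]; apply: uvw; rewrite u0 v0; congr (_, _).
have e20 : e / 2 != 0 by rewrite gt_eqF// divr_gt0.
have := (fe (e / 2) _).2; rewrite u0 v0 scaler0 addr0 => /(_ _)/esym/eqP.
rewrite -subr_eq0 addrAC subrr add0r mulf_eq0 (negbTE e20) orbF => h.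
by apply/eqP/h; rewrite gtr0_norm ?divr_gt0//; lra.
Qed.

Lemma D2_line_segment_at D f p u v (e : R) : open D -> C_ 2 D f ->
  (u, v) <> (0, 0) -> 0 < e ->
  (forall t, `|t| < e -> D (p + t *: (u, v)) /\ D2 f (p + t *: (u, v)) u v = 0) ->
  segment_at D f p.
Proof.
move=> oD C2 uv e0 fe; pose w := u * dx f p + v * dy f p.
exists [set (p.1 + u * t, p.2 + v * t, f p + w * t) | t in `]- e, e[].
split; first by exists u, v, w, e; split=> // -[u0 v0 _]; apply: uv; rewrite u0 v0.
move=> _ [t + <-]; rewrite /= in_itv/= -ltr_norml => te.
have [Dt _] := fe t te; have := D2_line_affine D f p u v e oD C2 fe t te.
by rewrite lineE in Dt *; split.
Qed.

(* Along a line of direction [(u, v)], [D2] satisfies [h' = r h]. *)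
Lemma D3_multiple_segment_at D f p u v (r : R * R -> R) : open D -> C_ 3 D f ->
  D p -> (u, v) <> (0, 0) -> D2 f p u v = 0 -> {for p, continuous r} ->
  (\forall q \near p, D3 f q u v = r q * D2 f q u v) ->
  segment_at D f p.
Proof.
move=> oD C3 Dp uv d20 rc d3r; pose M := `|r p| + 1.
have M0 : 0 < M by rewrite ltr_wpDl.
pose G := D `&` [set q | D3 f q u v = r q * D2 f q u v] `&` [set q | `|r q| < M].
have nG : nbhs p G.
  apply: filterI; first by apply: filterI => //; exact: open_nbhs_nbhs.
  have /cvgr_lt : `|r q| @[q --> p] --> `|r p| by exact: cvg_norm.
  by apply; rewrite ltrDl.
have [e e0 Ge] := open_line G° p (u, v) (open_interior _) nG.
have {}Ge t : `|t| < e -> G (p + t *: (u, v)) by move=> /Ge; exact: interior_subset.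
(* The bound [e / 2] keeps the closed interval inside the open one, and the other gives
   [M * e1 < 1], as [gronwall0] requires. *)
pose e1 := Num.min (e / 2) (2 * M)^-1.
have e10 : 0 < e1 by rewrite lt_min divr_gt0//= invr_gt0 mulr_gt0.
have e1e t : `|t| <= e1 -> `|t| < e.
  by rewrite le_min => /andP[te _]; rewrite (le_lt_trans te)//; lra.
have De t : `|t| <= e1 -> D (p + t *: (u, v)) by move=> /e1e/Ge[[]].
have Me1 : M * e1 < 1.
  rewrite (@le_lt_trans _ _ (M * (2 * M)^-1))//.
    by apply: (ler_wpM2l (ltW M0)); rewrite ge_min lexx orbT.
  by rewrite invfM mulrCA divff ?gt_eqF// mulr1 invf_lt1// ltr1n.
have d30 : forall t, `|t| <= e1 -> `|D3 f (p + t *: (u, v)) u v| <=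
    M * `|D2 f (p + t *: (u, v)) u v|.
  move=> t te; have [[_ /= ->] /= rM] := Ge _ (e1e _ te).
  by rewrite normrM; apply: ler_wpM2r => //; exact: ltW.
have h0 : D2 f (p + 0 *: (u, v)) u v = 0 by rewrite scale0r addr0.
have D2_0 := gronwall0 _ _ _ _ (ltW M0) Me1 h0
  (fun t te => is_derive_D3 D f p u v t oD C3 (De t te)) d30.
exact: (D2_line_segment_at D f p u v e1 oD (C_S _ _ _ C3) uv e10
  (fun t te => conj (De t (ltW te)) (D2_0 t (ltW te)))).
Qed.

End C3Lines.

(** * Generic points and the Baire category theorem *)

(** The points of [D] outside the interior of [P] already form a nowhere dense set [N]: an open set
    inside its closure would contain some [V'] that misses [N]. A constant sequence therefore shows
    that [N] is meager. *)
Lemma generic_of_dense_open (T : topologicalType) (D : set T) (P : T -> Prop) :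
  open D ->
  (forall V, open V -> V !=set0 -> V `<=` D ->
    exists V', [/\ open V', V' !=set0, V' `<=` V & V' `<=` [set p | P p]]) ->
  generic D P.
Proof.
move=> oD hP; pose N := D `\` interior [set p | P p].
exists N; split.
- exists (fun=> N); split; last by rewrite bigcup_const.
  move=> _; rewrite /nowhere_dense; apply/eqP/negPn/negP => /set0P[x xN].
  have [z [[Dz _] Nz]] : N `&` interior (closure N) !=set0.
    apply: (interior_subset xN).
    by apply: open_nbhs_nbhs; split=> //; exact: open_interior.
  have [|||V' [oV [y Vy] VV VP]] := hP (D `&` interior (closure N)).
  + by apply: openI => //; exact: open_interior.
  + by exists z.
  + by move=> w [].
  + have [w [[_ Nw] Vw]] : N `&` V' !=set0.
      by apply: (interior_subset (VV y Vy).2); exact: open_nbhs_nbhs.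
    by apply: Nw; rewrite /interior/= nbhsE; exists V'.
- by move=> x [].
- move=> p Dp Np; apply: contrapT => nP; apply: Np; split=> // /interior_subset.
  exact: nP.
Qed.

HB.instance Definition _ (T U : puniformType) := Pointed.on (T * U)%type.

(** Both projections of a Cauchy filter converge. The instance built on this makes [R * R] complete,
    so that [Baire] applies. *)
Lemma prod_cauchy_cvg (R : realType) (T U : completeNormedModType R)
    (F : set_system (T * U)) : ProperFilter F -> cauchy F -> cvg F.
Proof.
move=> FF /cauchy_ballP Fc.
have /cauchy_cvg c1 : cauchy (fst @ F).
  apply/cauchy_ballP => e e0; rewrite near_map2.
  by apply: filterS (Fc e e0) => -[x y] [].
have /cauchy_cvg c2 : cauchy (snd @ F).
  apply/cauchy_ballP => e e0; rewrite near_map2.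
  by apply: filterS (Fc e e0) => -[x y] [].
apply/cvg_ex; exists (lim (fst @ F), lim (snd @ F)).
have FE : ((z.1, z.2) @[z --> F]) = F.
  by apply/funext => A; congr F; apply/funext => -[].
by rewrite -[X in X --> _]FE; exact: cvg_pair c1 c2.
Qed.

HB.instance Definition _ (R : realType) (T U : completeNormedModType R) :=
  Uniform_isComplete.Build (T * U)%type (@prod_cauchy_cvg R T U).

(** The complements of the closures of the nowhere dense sets are open and dense, so by Baire [V]
    contains a point of all of them. *)
Lemma generic_meets_open (R : realType) (U : completeNormedModType R)
    (D : set U) (P : U -> Prop) (V : set U) :
  generic D P -> open V -> V !=set0 -> V `<=` D -> exists2 p, V p & P p.
Proof.
move=> [N [[F [nF NF]] _ DP]] oV V0 VD.
have /Baire/(_ V V0 oV) [p [Vp Fp]] n :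
    open (~` closure (F n)) /\ dense (~` closure (F n)).
  split; first by apply: closed_openC; exact: closed_closure.
  move=> O [x Ox] oO; apply: contrapT => /set0P/negP/negPn/eqP O0.
  have : interior (closure (F n)) x.
    rewrite /interior/= nbhsE; exists O => // y Oy; apply: contrapT => Fy.
    by have : set0 y by rewrite -O0.
  by rewrite nF.
exists p => //; apply: DP; first exact: VD.
by rewrite NF => -[n _ Fnp]; apply: (Fp n) => //; exact: subset_closure.
Qed.

(** Continuity is available only at points of [V], whence the intersection. *)
Lemma open_setI_preimage (T U : topologicalType) (V : set T) (g : T -> U) (A : set U) :
  open V -> open A -> (forall p, V p -> {for p, continuous g}) ->
  open (V `&` g @^-1` A).
Proof.
move=> oV oA cg; rewrite openE => p [Vp Agp]; apply: filterI.
  exact: open_nbhs_nbhs.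
by apply: cg => //; exact: open_nbhs_nbhs.
Qed.

(** * Continuity at a point of expressions in the derivatives *)

Section ContinuityAtPoint.
Context {R : realType} {T : topologicalType}.
Implicit Types (g h : T -> R) (p : T).

Lemma continuous_atD g h p : {for p, continuous g} -> {for p, continuous h} ->
  {for p, continuous (fun q => g q + h q)}.
Proof. exact: cvgD. Qed.

Lemma continuous_atB g h p : {for p, continuous g} -> {for p, continuous h} ->
  {for p, continuous (fun q => g q - h q)}.
Proof. exact: cvgB. Qed.

Lemma continuous_atN g p : {for p, continuous g} ->
  {for p, continuous (fun q => - g q)}.
Proof. exact: cvgN. Qed.

Lemma continuous_atM g h p : {for p, continuous g} -> {for p, continuous h} ->
  {for p, continuous (fun q => g q * h q)}.
Proof. exact: cvgM. Qed.

Lemma continuous_at_cst (x : R) p : {for p, continuous (fun=> x)}.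
Proof. exact: cvg_cst. Qed.

Lemma continuous_atX g n p : {for p, continuous g} ->
  {for p, continuous (fun q => g q ^+ n)}.
Proof.
by move=> cg; exact: (continuous_comp cg (@exprn_continuous _ n _)).
Qed.

Lemma continuous_at_div g h p : h p != 0 -> {for p, continuous g} ->
  {for p, continuous h} -> {for p, continuous (fun q => g q / h q)}.
Proof. by move=> h0 cg ch; apply: cvgM => //; exact: cvgV. Qed.

Lemma continuous_at_sqrt g p : {for p, continuous g} ->
  {for p, continuous (fun q => Num.sqrt (g q))}.
Proof. by move=> cg; exact: (continuous_comp cg (@sqrt_continuous _ _)). Qed.

End ContinuityAtPoint.

Ltac solve_continuous_at := lazymatch goal with
  | |- {for _, continuous (fun=> ?k)} => exact: (continuous_at_cst k)
  | |- {for _, continuous (fun q => @?g q - @?h q)} =>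
    apply: (continuous_atB g h); solve_continuous_at
  | |- {for _, continuous (fun q => @?g q + @?h q)} =>
    apply: (continuous_atD g h); solve_continuous_at
  | |- {for _, continuous (fun q => - @?g q)} =>
    apply: (continuous_atN g); solve_continuous_at
  | |- {for _, continuous (fun q => @?g q * @?h q)} =>
    apply: (continuous_atM g h); solve_continuous_at
  | |- {for _, continuous (fun q => @?g q ^+ ?n)} =>
    apply: (continuous_atX g n); solve_continuous_at
  | |- _ => try assumption
  end.

Section ContinuityForms.
Context {R : realType} {T : topologicalType}.
Implicit Types p : T.

Lemma continuous_cub (a b c d u v : T -> R) p :
  {for p, continuous a} -> {for p, continuous b} -> {for p, continuous c} ->
  {for p, continuous d} -> {for p, continuous u} -> {for p, continuous v} ->
  {for p, continuous (fun q => cub (a q) (b q) (c q) (d q) (u q) (v q))}.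
Proof.
by move=> ca cb cc cd cu cv; rewrite /cub; solve_continuous_at.
Qed.

Lemma continuous_quad_cub_res (a b c d g h k : T -> R) p :
  {for p, continuous a} -> {for p, continuous b} -> {for p, continuous c} ->
  {for p, continuous d} -> {for p, continuous g} -> {for p, continuous h} ->
  {for p, continuous k} ->
  {for p, continuous (fun q => quad_cub_res (a q) (b q) (c q) (d q) (g q) (h q) (k q))}.
Proof.
by move=> ca cb cc cd cg ch ck; rewrite /quad_cub_res; solve_continuous_at.
Qed.

(** The cofactor in [cubB], with one slope frozen at [x]. *)
Lemma continuous_cubB_factor (b c d m : T -> R) (x : R) p :
  {for p, continuous b} -> {for p, continuous c} -> {for p, continuous d} ->
  {for p, continuous m} ->
  {for p, continuous (fun q => 3 * b q + 3 * c q * (x + m q)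
    + d q * (x ^+ 2 + x * m q + m q ^+ 2))}.
Proof. by move=> cb cc cd cm; solve_continuous_at. Qed.

Lemma continuous_cub_double_root_factor (c d m : T -> R) (x : R) p :
  {for p, continuous c} -> {for p, continuous d} -> {for p, continuous m} ->
  {for p, continuous (fun q => 3 * (c q - m q * d q) + (x + m q) * d q)}.
Proof. by move=> cc cd cm; solve_continuous_at. Qed.

End ContinuityForms.

Lemma open_open_disk (R : realType) (c : R * R) (r : R) : open (open_disk c r).
Proof.
have -> : open_disk c r = [set: R * R] `&`
    (fun p => (p.1 - c.1) ^+ 2 + (p.2 - c.2) ^+ 2) @^-1` [set x | x < r ^+ 2].
  by rewrite setTI.
apply: open_setI_preimage; [exact: openT|exact: open_lt|] => p _.
apply: continuous_atD; apply: continuous_atX; apply: continuous_atB;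
  try exact: continuous_at_cst; [exact: cvg_fst|exact: cvg_snd].
Qed.

(** * Segments from the resultant condition, and the converse *)

Section Ruling.
#[local] Opaque dx dy.
Context {R : realType} (D : set (R * R)) (f : R * R -> R).
Context (oD : open D) (C3 : C_ 3 D f).
Implicit Types (V : set (R * R)) (p q : R * R).

Let fxx := dx (dx f).
Let fxy := dy (dx f).
Let fyy := dy (dy f).
Let fxxx := dx (dx (dx f)).
Let fxxy := dy (dx (dx f)).
Let fxyy := dy (dy (dx f)).
Let fyyy := dy (dy (dy f)).

Let Cx := C_dx _ _ _ C3.
Let Cy := C_dy _ _ _ C3.
Let cfxx p (Dp : D p) : {for p, continuous fxx} := C_continuous _ _ _ _ (C_dx _ _ _ Cx) Dp.
Let cfxy p (Dp : D p) : {for p, continuous fxy} := C_continuous _ _ _ _ (C_dy _ _ _ Cx) Dp.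
Let cfyy p (Dp : D p) : {for p, continuous fyy} := C_continuous _ _ _ _ (C_dy _ _ _ Cy) Dp.
Let cfxxx p (Dp : D p) : {for p, continuous fxxx} :=
  C_continuous _ _ _ _ (C_dx _ _ _ (C_dx _ _ _ Cx)) Dp.
Let cfxxy p (Dp : D p) : {for p, continuous fxxy} :=
  C_continuous _ _ _ _ (C_dy _ _ _ (C_dx _ _ _ Cx)) Dp.
Let cfxyy p (Dp : D p) : {for p, continuous fxyy} :=
  C_continuous _ _ _ _ (C_dy _ _ _ (C_dy _ _ _ Cx)) Dp.
Let cfyyy p (Dp : D p) : {for p, continuous fyyy} :=
  C_continuous _ _ _ _ (C_dy _ _ _ (C_dy _ _ _ Cy)) Dp.

(** The radicand in [slope], opposite in sign to the expression in condition (3). *)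
Definition disc p := fxy p ^+ 2 - fxx p * fyy p.

Definition res p := quad_cub_res (fxx p) (fxy p) (fyy p) (fxxx p) (fxxy p) (fxyy p) (fyyy p).

Lemma continuous_disc p : D p -> {for p, continuous disc}.
Proof.
move=> Dp; apply: continuous_atB; first by apply: continuous_atX; exact: cfxy.
by apply: continuous_atM; [exact: cfxx|exact: cfyy].
Qed.

Lemma continuous_res p : D p -> {for p, continuous res}.
Proof.
move=> Dp; exact: (continuous_quad_cub_res _ _ _ _ _ _ _ _ (cfxx _ Dp) (cfxy _ Dp)
  (cfyy _ Dp) (cfxxx _ Dp) (cfxxy _ Dp) (cfxyy _ Dp) (cfyyy _ Dp)).
Qed.

Definition fslope (s : R) p := slope (fxx p) (fxy p) (fyy p) s.

Lemma continuous_fslope s p : D p -> fyy p != 0 -> {for p, continuous (fslope s)}.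
Proof.
move=> Dp c0; apply: continuous_at_div => //; last exact: cfyy.
apply: continuous_atD; first by apply: continuous_atN; exact: cfxy.
apply: continuous_atM; first exact: continuous_at_cst.
by apply: continuous_at_sqrt; exact: continuous_disc.
Qed.

Lemma one_slope_neq0 (m : R) : (1, m) <> (0, 0) :> R * R.
Proof. by case=> /eqP; rewrite oner_eq0. Qed.

Lemma hyperbolic_segment_at V s p : open V -> V `<=` D ->
  (forall q, V q -> fyy q != 0) -> (forall q, V q -> 0 < disc q) ->
  s ^+ 2 = 1 -> (forall q, V q -> D3 f q 1 (fslope s q) = 0) ->
  V p -> segment_at D f p.
Proof.
move=> oV VD c0 d0 s2 k0 Vp; have Dp := VD p Vp; pose mu := fslope s p.
(* With the slope frozen at [mu], [D2] and [D3] at [q] are [mu - fslope s q] times [den q] and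
   [num q], so [num / den] serves as the coefficient [r]. *)
pose den q := fyy q * (mu - fslope (- s) q).
pose num q := 3 * fxxy q + 3 * fxyy q * (mu + fslope s q)
  + fyyy q * (mu ^+ 2 + mu * fslope s q + fslope s q ^+ 2).
have cs s' := continuous_fslope s' p Dp (c0 p Vp).
have cden : {for p, continuous den}.
  apply: continuous_atM; first exact: cfyy.
  by apply: continuous_atB; [exact: continuous_at_cst|exact: cs].
have cnum : {for p, continuous num} :=
  continuous_cubB_factor _ _ _ _ mu _ (cfxxy _ Dp) (cfxyy _ Dp) (cfyyy _ Dp) (cs s).
(* The two roots at [p] are distinct because [disc p] is positive. *)
have den0 : den p != 0.
  rewrite mulf_neq0 ?c0//.
  have -> : mu - fslope (- s) p = 2 * s * Num.sqrt (disc p) / fyy p.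
    by rewrite /mu /fslope /slope -/(disc p); field; exact: c0.
  have s0 : s != 0 by apply/eqP => s0; move: s2 => /eqP; rewrite s0 expr0n/= eq_sym oner_eq0.
  by rewrite !mulf_neq0 ?pnatr_eq0 ?invr_eq0 ?c0// sqrtr_eq0 -ltNge d0.
apply: (D3_multiple_segment_at D f p 1 mu (fun q => num q / den q)) => //.
- exact: one_slope_neq0.
- by apply: quad_slope => //; [exact: c0|exact: ltW (d0 p Vp)].
- exact: continuous_at_div.
- have : nbhs p (V `&` [set q | den q != 0]).
    apply: filterI; first exact: open_nbhs_nbhs.
    exact: (cvgr_neq0 _ cden den0).
  apply: filterS => q [Vq dq].
  have k : D3 f q 1 mu = (mu - fslope s q) * num q.
    by rewrite -[LHS]subr0 -(k0 q Vq); exact: cubB.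
  have h : D2 f q 1 mu = (mu - fslope s q) * den q.
    rewrite mulrCA mulrA; exact: (quad_slopes _ _ _ _ _ (c0 q Vq) (ltW (d0 q Vq)) s2).
  by rewrite k h mulrCA divfK.
Qed.

Lemma parabolic_segment_at V p : open V -> V `<=` D ->
  (forall q, V q -> fyy q != 0) -> (forall q, V q -> disc q = 0) ->
  V p -> segment_at D f p.
Proof.
move=> oV VD c0 d0 Vp; have Dp := VD p Vp.
have ac q : V q -> fxy q ^+ 2 = fxx q * fyy q.
  by move=> /d0/eqP; rewrite subr_eq0 => /eqP.
pose mu := - fxy p / fyy p; pose dl q := mu + fxy q / fyy q.
have dl0 : dl p = 0 by rewrite /dl /mu mulNr addNr.
have cbc : {for p, continuous (fun q => fxy q / fyy q)}.
  by apply: continuous_at_div; [exact: c0|exact: cfxy|exact: cfyy].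
(* Both [D2] and [D3] carry the factor [dl q ^+ 2], and [r] is the quotient of the remaining
   factors, so its only denominators are powers of [fyy]. *)
pose r q := (3 * (fxyy q - fxy q / fyy q * fyyy q) + dl q * fyyy q) / fyy q.
have cr : {for p, continuous r}.
  apply: continuous_at_div; [exact: c0| |exact: cfyy].
  exact: (continuous_cub_double_root_factor _ _ _ mu _ (cfxyy _ Dp) (cfyyy _ Dp) cbc).
have h q : V q -> D2 f q 1 mu = fyy q * dl q ^+ 2.
  by move=> Vq; exact: (quad_double_root _ _ _ _ (c0 q Vq) (ac q Vq)).
apply: (D3_multiple_segment_at D f p 1 mu r) => //.
- exact: one_slope_neq0.
- by rewrite h// dl0 expr0n mulr0.
- have : nbhs p V by exact: open_nbhs_nbhs.
  apply: filterS => q Vq; have [hA hB] := degenerate_D2_derive D V f q oD C3 oV VD Vq ac.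
  have k := cub_double_root _ _ _ _ _ _ _ mu (c0 q Vq) (ac q Vq) hA hB.
  by rewrite [LHS]k (h q Vq) mulrA (divfK (c0 q Vq)) mulrC.
Qed.

Lemma vertical_segment_at V p : open V -> V `<=` D ->
  (forall q, V q -> fyy q = 0) -> V p -> segment_at D f p.
Proof.
move=> oV VD c0 Vp; have [e e0 Ve] := open_line V p (0, 1) oV Vp.
apply: (D2_line_segment_at D f p 0 1 e oD (C_S _ _ _ C3) _ e0).
  by case=> /eqP; rewrite oner_eq0.
move=> t /Ve Vt; split; first exact: VD.
by rewrite /D2 -/fyy (c0 _ Vt) /quad; ring.
Qed.

(** Any open [V] is shrunk until the vertical, the parabolic or the hyperbolic construction works at
    all of its points. *)
Lemma generic_segment_at : (forall p, D p -> 0 <= disc p /\ res p = 0) ->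
  generic D (segment_at D f).
Proof.
move=> dr; apply: generic_of_dense_open => // V oV V0 VD.
have [c0|/existsNP[q /not_implyP[Vq /eqP cq]]] := pselect (forall q, V q -> fyy q = 0).
  by exists V; split=> // p Vp; exact: (vertical_segment_at V).
pose V1 := V `&` fyy @^-1` [set x | x != 0].
have oV1 : open V1.
  exact: (open_setI_preimage _ _ _ _ _ oV (@open_neq _ 0) (fun p Vp => cfyy p (VD p Vp))).
have V1D : V1 `<=` D by move=> p [/VD].
have c0 p : V1 p -> fyy p != 0 by case.
have [d0|/existsNP[p /not_implyP[V1p /negP]]] := pselect (forall p, V1 p -> disc p <= 0).
  exists V1; split=> //; [by exists q|by move=> p []|].
  move=> p V1p; apply: (parabolic_segment_at V1) => // z V1z.
  by apply/eqP; rewrite eq_le d0// (dr z (V1D z V1z)).1.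
rewrite -ltNge => dp.
pose V2 := V1 `&` disc @^-1` [set x | 0 < x].
have oV2 : open V2.
  exact: (open_setI_preimage _ _ _ _ _ oV1 (@open_gt _ 0)
    (fun z V1z => continuous_disc z (V1D z V1z))).
have V2D : V2 `<=` D by move=> z [/V1D].
have c02 z : V2 z -> fyy z != 0 by case=> /c0.
have d02 z : V2 z -> 0 < disc z by case.
have [k0|/existsNP[w /not_implyP[V2w /eqP kw]]] :=
    pselect (forall z, V2 z -> D3 f z 1 (fslope 1 z) = 0).
  exists V2; split=> //; [by exists p|by move=> z [[]]|] => z V2z.
  by apply: (hyperbolic_segment_at V2 1) => //; rewrite expr1n.
(* Where the cubic is nonzero at the first slope, the product formula for the resultant makes it
   vanish at the other one. *)
pose V3 := V2 `&` (fun z => D3 f z 1 (fslope 1 z)) @^-1` [set x | x != 0].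
have oV3 : open V3.
  apply: (open_setI_preimage _ _ _ _ _ oV2 (@open_neq _ 0)) => z V2z; have Dz := V2D z V2z.
  exact: (continuous_cub _ _ _ _ _ _ _ (cfxxx _ Dz) (cfxxy _ Dz) (cfxyy _ Dz)
    (cfyyy _ Dz) (continuous_at_cst _ _) (continuous_fslope 1 z Dz (c02 z V2z))).
exists V3; split=> //; [by exists w|by move=> z [[[]]]|] => z V3z.
have sN1 : (-1 : R) ^+ 2 = 1 by rewrite sqrrN expr1n.
apply: (hyperbolic_segment_at V3 (-1) z oV3 _ _ _ sN1 _ V3z).
- by move=> y [/V2D].
- by move=> y [/c02].
- by move=> y [/d02].
move=> y [V2y /= ky]; have := (dr y (V2D y V2y)).2.
rewrite /res quad_cub_res_slopes; [|exact: c02|exact: ltW (d02 y V2y)].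
move/eqP; rewrite -mulrA mulf_eq0 (negbTE (expf_neq0 3 (c02 y V2y)))/=.
by rewrite mulf_eq0 => /orP[h|/eqP//]; move: ky; rewrite /D3 /fslope (eqP h) eqxx.
Qed.

Lemma disc_res_of_generic : generic D (segment_at D f) ->
  forall p, D p -> 0 <= disc p /\ res p = 0.
Proof.
move=> gen; have seg_dr p : D p -> segment_at D f p -> 0 <= disc p /\ res p = 0.
  move=> Dp /(segment_at_D2_D3 D f p oD C3) /quad_cub_common_rootP[d r].
  by split=> //; rewrite /disc subr_ge0 -subr_le0.
(* A value of [g] in the open set [A] persists on an open subset of [D]. By Baire that subset has a
   point with a segment, where such values are excluded. *)
have empty (g : R * R -> R) (A : set R) : open A ->
    (forall p, D p -> {for p, continuous g}) ->
    (forall p, D p -> segment_at D f p -> ~ A (g p)) -> forall p, D p -> ~ A (g p).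
  move=> oA cg gA p Dp Ap.
  have [||| q [Dq Aq] sq] := generic_meets_open R _ D _ (D `&` g @^-1` A) gen.
  - exact: open_setI_preimage.
  - by exists p.
  - by move=> q [].
  - exact: (gA q Dq sq).
have seg_d q : D q -> segment_at D f q -> ~ disc q < 0.
  by move=> Dq /(seg_dr q Dq)[d _]; rewrite ltNge d.
have seg_r q : D q -> segment_at D f q -> ~ res q != 0.
  by move=> Dq /(seg_dr q Dq)[_ ->]; rewrite eqxx.
move=> p Dp; split.
- rewrite leNgt; apply/negP.
  exact: (empty disc [set x | x < 0] (@open_lt _ 0) continuous_disc seg_d p Dp).
- apply/eqP/negPn/negP.
  exact: (empty res [set x | x != 0] (@open_neq _ 0) continuous_res seg_r p Dp).
Qed.

End Ruling.

Theorem theorem4 (R : realType) (c : R * R) (r : R) (f : R * R -> R)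
    (r_gt0 : 0 < r) (C3f : C_ 3 (open_disk c r) f) :
  let D := open_disk c r in
  let fxx := dx (dx f) in
  let fxy := dy (dx f) in
  let fyy := dy (dy f) in
  let fxxx := dx (dx (dx f)) in
  let fxxy := dy (dx (dx f)) in
  let fxyy := dy (dy (dx f)) in
  let fyyy := dy (dy (dy f)) in
  let cond1 :=
    generic D (fun p => exists S : set (R * R * R),
      line_segment_through (p, f p) S /\ S `<=` graph D f) in
  let cond2 :=
    forall p, D p -> exists u v : R,
      [/\ (u, v) <> (0, 0),
          fxx p * u ^+ 2 + 2 * fxy p * u * v + fyy p * v ^+ 2 = 0 &
          fxxx p * u ^+ 3 + 3 * fxxy p * u ^+ 2 * v
          + 3 * fxyy p * u * v ^+ 2 + fyyy p * v ^+ 3 = 0] in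
  let cond3 :=
    forall p, D p ->
      fxx p * fyy p - fxy p ^+ 2 <= 0 /\
      fyy p ^+ 3 * fxxx p ^+ 2
      + 6 * fyy p * fxxx p * fyyy p * fxy p * fxx p
      - 6 * fyy p ^+ 2 * fxxx p * fxyy p * fxx p
      - 6 * fyyy p * fxy p * fxx p ^+ 2 * fxyy p
      + 9 * fyy p * fxyy p ^+ 2 * fxx p ^+ 2
      - 6 * fxy p * fyy p ^+ 2 * fxxy p * fxxx p
      + 12 * fxy p ^+ 2 * fxxy p * fyyy p * fxx p
      - 18 * fxy p * fyy p * fxxy p * fxyy p * fxx p
      + 12 * fyy p * fxyy p * fxy p ^+ 2 * fxxx p
      - 8 * fyyy p * fxy p ^+ 3 * fxxx p
      + 9 * fxx p * fyy p ^+ 2 * fxxy p ^+ 2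
      - 6 * fyy p * fxxy p * fyyy p * fxx p ^+ 2
      + fyyy p ^+ 2 * fxx p ^+ 3 = 0 in
  (cond1 <-> cond2) /\ (cond2 <-> cond3).
Proof.
move=> D fxx fxy fyy fxxx fxxy fxyy fyyy cond1 cond2 cond3.
have oD : open D := open_open_disk R c r.
(* Both conditions are, by conversion, the two sides of the algebraic criterion at each point; (1)
   is then compared with (3). *)
have c23 : cond2 <-> cond3.
  by split=> h p Dp; [apply/quad_cub_common_rootP; exact: h|
    apply/(quad_cub_common_rootP _ _ _ _ _ _ _).2; exact: h].
split=> //; split=> [g|/c23 h].
  apply/c23 => p Dp; have [d0 r0] := disc_res_of_generic D f oD C3f g p Dp.
  by split; [rewrite -oppr_ge0 opprB; exact: d0|exact: r0].
apply: (generic_segment_at D f oD C3f) => p Dp; have [d0 r0] := h p Dp.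
by split; [rewrite /disc subr_ge0 -subr_le0; exact: d0|exact: r0].
Qed.
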